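(* The polynomial functors of $\mathcal{F}_{quad}$ are in the image of the functor $\iota:\mathcal{F}\to\mathcal{F}_{quad}$; i.e. every polynomial functor of $\mathcal{F}_{quad}$ is isomorphic to $\iota(G)$ for some $G$ in $\mathcal{F}$.
   Context: A quadratic space is a finite-dimensional $\mathbb{F}_2$-vector space with a quadratic form $q$, with associated bilinear form $B(x,y)=q(x+y)+q(x)+q(y)$; it is nondegenerate if $B$ is. $\mathcal{E}$ (resp. $\mathcal{E}^f$) is the category of all (resp. finite-dimensional) $\mathbb{F}_2$-vector spaces. $\bot$ denotes orthogonal sum. $\mathcal{E}_q$: nondegenerate quadratic spaces with linear maps preserving the quadratic forms (these are injective). $H_0$ (resp. $H_1$) is the nondegenerate quadratic space of dimension $2$ with Arf invariant $0$ (resp. $1$). $\mathcal{T}_q$: same objects as $\mathcal{E}_q$; $\mathrm{Hom}_{\mathcal{T}_q}(V,W)$ is the set of equivalence classes $[V\xrightarrow{f}X\xleftarrow{g}W]$ of diagrams in $\mathcal{E}_q$, for the equivalence relation generated by: $(f,g)$ is related to $(\alpha f,\alpha g)$ for every morphism $\alpha:X\to X'$ of $\mathcal{E}_q$. Every morphism has a representative $[V\xrightarrow{f}W\bot W'\xleftarrow{i_W}W]$ with $i_W$ the canonical inclusion; composition is $[W\xrightarrow{\varphi}Z\bot L\leftarrow Z]\circ[V\xrightarrow{f}W\bot W'\leftarrow W]=[V\xrightarrow{(\varphi\bot\mathrm{Id})f}Z\bot L\bot W'\leftarrow Z]$. Orthogonal sum induces a functor $\bot:\mathcal{T}_q\times\mathcal{T}_q\to\mathcal{T}_q$.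 $\mathcal{F}_{quad}$ is the category of functors $\mathcal{T}_q\to\mathcal{E}$. $\mathcal{F}$ is the category of functors $\mathcal{E}^f\to\mathcal{E}$. The functor $\epsilon:\mathcal{T}_q\to\mathcal{E}^f$ sends a quadratic space to its underlying vector space and $[V\xrightarrow{f}W\bot W'\xleftarrow{i_W}W]$ to $p_W\circ f$, with $p_W$ the orthogonal projection onto $W$. $\iota:\mathcal{F}\to\mathcal{F}_{quad}$ is precomposition with $\epsilon$. Difference functors $\Delta_{H_i}:\mathcal{F}_{quad}\to\mathcal{F}_{quad}$, $i\in\{0,1\}$: $\Delta_{H_i}F(V)=\ker\big(F(V\bot H_i)\xrightarrow{F(T_i)}F(V)\big)$ with $T_i=[V\bot H_i\xrightarrow{\mathrm{Id}}V\bot H_i\xleftarrow{i_V}V]$. A functor $F$ of $\mathcal{F}_{quad}$ is polynomial of degree $0$ if and only if $\Delta_{H_0}F=\Delta_{H_1}F=0$; it is polynomial of degree at most $d+1$ if and only if $\Delta_{H_0}F$ and $\Delta_{H_1}F$ are polynomial of degree at most $d$. $F$ is polynomial if it is polynomial of degree at most $d$ for some integer $d\ge 0$. *)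

(* Defs.v *)
From HB Require Import structures.
From Stdlib Require Import Relation_Operators.
From mathcomp Require Import all_boot all_order all_algebra.

Set Implicit Arguments.
Unset Strict Implicit.
Unset Printing Implicit Defensive.

Import GRing.Theory.
Local Open Scope ring_scope.

(** Equality of morphisms is an equivalence relation [heq] carried by the
    hom-types: a set of equivalence classes of diagrams is the type of diagrams
    together with the equivalence relation, and a map out of it is a map on
    diagrams compatible with the relation. *)
Record category := Category {
  obj :> Type;
  hom : obj -> obj -> Type;
  heq : forall a b, hom a b -> hom a b -> Prop;
  idm : forall a, hom a a;
  compm : forall a b c, hom b c -> hom a b -> hom a c;
  heq_refl : forall a b (f : hom a b), heq f f;
  heq_sym : forall a b (f g : hom a b), heq f g -> heq g f;
  heq_trans : forall a b (f g h : hom a b), heq f g -> heq g h -> heq f h;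
  comp_heq : forall a b c (g g' : hom b c) (f f' : hom a b),
    heq g g' -> heq f f' -> heq (compm g f) (compm g' f');
  comp_idl : forall a b (f : hom a b), heq (compm (idm b) f) f;
  comp_idr : forall a b (f : hom a b), heq (compm f (idm a)) f;
  compA : forall a b c d (h : hom c d) (g : hom b c) (f : hom a b),
    heq (compm h (compm g f)) (compm (compm h g) f) }.

Arguments hom {C} a b : rename.
Arguments heq {C a b} f g : rename.
Arguments idm {C} a : rename.
Arguments compm {C a b c} g f : rename.

Record functor (C D : category) := Functor {
  fobj :> C -> D;
  fmap : forall a b : C, hom a b -> hom (fobj a) (fobj b);
  fmap_heq : forall (a b : C) (f g : hom a b), heq f g -> heq (fmap f) (fmap g);
  fmap_id : forall a : C, heq (fmap (idm a)) (idm (fobj a));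
  fmap_comp : forall (a b c : C) (g : hom b c) (f : hom a b),
    heq (fmap (compm g f)) (compm (fmap g) (fmap f)) }.

Arguments fmap {C D} f {a b} _ : rename.

Definition is_iso (C : category) (a b : C) (f : hom a b) : Prop :=
  exists g : hom b a, heq (compm g f) (idm a) /\ heq (compm f g) (idm b).

Definition functor_isomorphic (C D : category) (F G : functor C D) : Prop :=
  exists eta : forall a : C, hom (F a) (G a),
    (forall (a b : C) (f : hom a b),
       heq (compm (eta b) (fmap F f)) (compm (fmap G f) (eta a)))
    /\ (forall a : C, is_iso (eta a)).

Program Definition functor_comp (A B C : category)
    (G : functor B C) (F : functor A B) : functor A C :=
  @Functor A C (fun a => G (F a)) (fun a b f => fmap G (fmap F f)) _ _ _.
Next Obligation. by move=> A B C G F a b f g fg; do 2!apply: fmap_heq. Qed.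
Next Obligation.
move=> A B C G F a; apply: heq_trans (fmap_id G _).
by apply: fmap_heq; apply: fmap_id.
Qed.
Next Obligation.
move=> A B C G F a b c g f; apply: heq_trans (fmap_comp G _ _).
by apply: fmap_heq; apply: fmap_comp.
Qed.

Program Definition Vect : category :=
  @Category (lmodType 'F_2) (fun U V => {linear U -> V})
    (fun U V f g => f =1 g) (fun U => idfun) (fun U V W g f => g \o f)
    _ _ _ _ _ _ _.
Next Obligation. by []. Qed.
Next Obligation. by move=> U V f g e x; rewrite e. Qed.
Next Obligation. by move=> U V f g h e e' x; rewrite e e'. Qed.
Next Obligation. by move=> U V W g g' f f' eg ef x /=; rewrite ef eg. Qed.
Next Obligation. by []. Qed.
Next Obligation. by []. Qed.
Next Obligation. by []. Qed.

Program Definition FinVect : category :=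
  @Category (vectType 'F_2) (fun U V => {linear U -> V})
    (fun U V f g => f =1 g) (fun U => idfun) (fun U V W g f => g \o f)
    _ _ _ _ _ _ _.
Next Obligation. by []. Qed.
Next Obligation. by move=> U V f g e x; rewrite e. Qed.
Next Obligation. by move=> U V f g h e e' x; rewrite e e'. Qed.
Next Obligation. by move=> U V W g g' f f' eg ef x /=; rewrite ef eg. Qed.
Next Obligation. by []. Qed.
Next Obligation. by []. Qed.
Next Obligation. by []. Qed.

Definition polar (V : vectType 'F_2) (q : V -> 'F_2) (x y : V) : ('F_2)^o :=
  q (x + y) + q x + q y.

Record qspace := QSpace {
  qcarrier :> vectType 'F_2;
  qf : qcarrier -> 'F_2;
  qfZ : forall (a : 'F_2) (x : qcarrier), qf (a *: x) = a ^+ 2 * qf x;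
  polar_linear : forall x : qcarrier, linear (polar qf x);
  qf_nondeg : forall x : qcarrier, (forall y, polar qf x y = 0) -> x = 0 }.

Arguments qf {q} x : rename.

Definition B (V : qspace) : V -> V -> ('F_2)^o := polar (@qf V).

HB.instance Definition _ (V : qspace) (x : V) :=
  GRing.isLinear.Build 'F_2 V ('F_2)^o *:%R (B x) (polar_linear x).

Lemma addvv (V : lmodType 'F_2) (x : V) : x + x = 0.
Proof. by rewrite -[x]scale1r -scalerDl (_ : 1 + 1 = 0) ?scale0r //; apply/val_inj. Qed.

Lemma oppv (V : lmodType 'F_2) (x : V) : - x = x.
Proof. by apply/esym/eqP; rewrite -addr_eq0 addvv. Qed.

Lemma addF2 (x : 'F_2) : x + x = 0.
Proof. exact: (@addvv ('F_2)^o x). Qed.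

Section QTheory.
Variable V : qspace.
Implicit Types x y z : V.

Lemma qfD x y : qf (x + y) = qf x + qf y + B x y.
Proof.
by rewrite /B /polar [RHS]addrC -[_ + qf x + qf y]addrA -addrA addF2 addr0.
Qed.

Lemma BC x y : B x y = B y x.
Proof. by rewrite /B /polar addrAC [x + y]addrC. Qed.

Lemma BDl x y z : B (x + y) z = B x z + B y z.
Proof. by rewrite BC raddfD /= ![B z _]BC. Qed.

Lemma BZl a x z : B (a *: x) z = a * B x z.
Proof. by rewrite BC linearZ /= BC. Qed.

Lemma qf0 : qf (0 : V) = 0.
Proof. by rewrite -(scale0r (0 : V)) qfZ expr2 !mul0r. Qed.

Lemma B0l z : B 0 z = 0. Proof. by rewrite BC linear0. Qed.

Lemma B_ext x y : (forall z, B x z = B y z) -> x = y.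
Proof.
move=> e; apply/eqP; rewrite -subr_eq0 oppv; apply/eqP/(@qf_nondeg V) => z.
by rewrite -/(B _ _) BDl e addvv.
Qed.

End QTheory.

Record isometry (V W : qspace) := Isometry {
  iso_fun :> {linear V -> W};
  iso_qf : forall x, qf (iso_fun x) = qf x }.

Definition iso_id (V : qspace) : isometry V V :=
  @Isometry V V idfun (fun x => erefl).

Program Definition iso_comp (U V W : qspace) (g : isometry V W)
    (f : isometry U V) : isometry U W :=
  @Isometry U W (g \o f) _.
Next Obligation. by move=> U V W g f x /=; rewrite !iso_qf. Qed.

Lemma iso_B (V W : qspace) (f : isometry V W) x y : B (f x) (f y) = B x y.
Proof. by rewrite /B /polar -raddfD !iso_qf. Qed.

Lemma iso_inj (V W : qspace) (f : isometry V W) : injective f.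
Proof.
by move=> x y e; apply: B_ext => z; rewrite -(iso_B f) e iso_B.
Qed.

Section OSum.
Variables V W : qspace.
Let q (x : (V * W)%type) : 'F_2 := qf x.1 + qf x.2.

Let polarE x y : polar q x y = B x.1 y.1 + B x.2 y.2.
Proof. by rewrite /B /polar /q /= [X in X + _ = _]addrACA [LHS]addrACA. Qed.

Let qZ a x : q (a *: x) = a ^+ 2 * q x.
Proof. by rewrite /q !qfZ mulrDr. Qed.

Let q_linear x : linear (polar q x).
Proof. by move=> a y z; rewrite !polarE !linearP [RHS]/= scalerDr addrACA. Qed.

Let q_nondeg x : (forall y, polar q x y = 0) -> x = 0.
Proof.
case: x => x1 x2 h; congr pair; apply: qf_nondeg => y.
  by have:= h (y, 0); rewrite polarE /= linear0 addr0.
by have:= h (0, y); rewrite polarE /= linear0 add0r.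
Qed.

Definition osum : qspace := QSpace qZ q_linear q_nondeg.

Lemma osum_BE (x y : osum) : B x y = B x.1 y.1 + B x.2 y.2.
Proof. exact: polarE. Qed.

Let q_inl x : q (x, 0) = qf x.
Proof. by rewrite /q /= qf0 addr0. Qed.

Definition osum_inl_fun (x : V) : osum := (x, 0).
Lemma osum_inl_linear : linear osum_inl_fun.
Proof. by move=> a x y; congr pair; rewrite /= scaler0 addr0. Qed.
HB.instance Definition _ :=
  GRing.isLinear.Build 'F_2 V osum *:%R osum_inl_fun osum_inl_linear.

Definition osum_inl : isometry V osum := @Isometry V osum osum_inl_fun q_inl.

End OSum.

Notation "V _|_ W" := (osum V W) (at level 50, left associativity).

Section OSumMap.
Variables (V W V' W' : qspace) (f : isometry V V') (g : isometry W W').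

Definition osum_map_fun (x : V _|_ W) : V' _|_ W' := (f x.1, g x.2).
Lemma osum_map_linear : linear osum_map_fun.
Proof. by move=> a x y; congr pair; rewrite linearP. Qed.
HB.instance Definition _ :=
  GRing.isLinear.Build 'F_2 (V _|_ W) (V' _|_ W') *:%R osum_map_fun
    osum_map_linear.

Lemma osum_map_qf x : qf (osum_map_fun x) = qf x.
Proof. by case: x => x y; congr (_ + _); apply: iso_qf. Qed.

Definition osum_map : isometry (V _|_ W) (V' _|_ W') :=
  @Isometry (V _|_ W) (V' _|_ W') osum_map_fun osum_map_qf.

End OSumMap.

Section Dual.
Variable V : qspace.

Definition to_dual_fun (x : V) : 'Hom(V, ('F_2)^o) := linfun (B x).
Lemma to_dual_funE x y : to_dual_fun x y = B x y.
Proof. exact: lfunE. Qed.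

Lemma to_dual_linear : linear to_dual_fun.
Proof.
move=> a x y; apply/lfunP => z.
by rewrite add_lfunE scale_lfunE !to_dual_funE BDl BZl.
Qed.
HB.instance Definition _ :=
  GRing.isLinear.Build 'F_2 V 'Hom(V, ('F_2)^o) *:%R to_dual_fun to_dual_linear.

Definition to_dual : 'Hom(V, 'Hom(V, ('F_2)^o)) := linfun to_dual_fun.

Lemma to_dualE x y : to_dual x y = B x y.
Proof. by rewrite lfunE; apply: to_dual_funE. Qed.

Lemma to_dual_ker : lker to_dual == 0%VS.
Proof.
by apply/lker0P => x y e; apply: B_ext => z; rewrite -!to_dualE e.
Qed.

Lemma to_dualK l : to_dual (to_dual^-1%VF l) = l.
Proof.
apply: limg_lfunVK.
suff -> : limg to_dual = fullv by apply: memvf.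
apply/eqP; rewrite eqEdim subvf /= limg_dim_eq; last first.
  by rewrite (eqP to_dual_ker) capv0.
by rewrite !dimvf /dim /= muln1.
Qed.

End Dual.

Section Adjoint.
Variables (W X : qspace) (g : isometry W X).

(** The adjoint of [g]: if [x] is decomposed along the orthogonal sum of the
    image of [g] and its orthogonal complement, the component of [x] on the
    image of [g] is [g (adj x)]. *)
Definition adj (x : X) : W :=
  ((to_dual W)^-1)%VF ((to_dual X x) \o (linfun g))%VF.

Lemma adjP x w : B (adj x) w = B x (g w).
Proof. by rewrite -to_dualE to_dualK comp_lfunE to_dualE lfunE. Qed.

Lemma adj_linear : linear adj.
Proof.
move=> a x y; apply: B_ext => w.
by rewrite adjP !(BDl, BZl) !adjP.
Qed.
HB.instance Definition _ := GRing.isLinear.Build 'F_2 X W *:%R adj adj_linear.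

Lemma adjK w : adj (g w) = w.
Proof. by apply: B_ext => z; rewrite adjP iso_B. Qed.

Lemma adj_uniq x w : (forall z, B x (g z) = B w z) -> adj x = w.
Proof. by move=> e; apply: B_ext => z; rewrite adjP. Qed.

Definition orth : {vspace X} := lker (linfun adj).

Lemma orthP x : reflect (forall w, B x (g w) = 0) (x \in orth).
Proof.
rewrite memv_ker lfunE /=; apply: (iffP eqP) => [e w | e].
  by rewrite -adjP e B0l.
by apply: adj_uniq => z; rewrite e B0l.
Qed.

Let q (x : subvs_of orth) : 'F_2 := qf (vsval x).

Let polarE x y : polar q x y = B (vsval x) (vsval y).
Proof. by []. Qed.

Let qZ a x : q (a *: x) = a ^+ 2 * q x.
Proof. by rewrite /q linearZ qfZ. Qed.

Let q_linear x : linear (polar q x).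
Proof. by move=> a y z; rewrite !polarE !linearP. Qed.

Lemma sub_adj_orth x : x - g (adj x) \in orth.
Proof. by apply/orthP => w; rewrite oppv BDl iso_B adjP addvv. Qed.

Let q_nondeg x : (forall y, polar q x y = 0) -> x = 0.
Proof.
move=> h; apply: val_inj; apply: qf_nondeg => z; rewrite -/(B _ _).
rewrite -[z](subrK (g (adj z))) linearD /=.
rewrite (orthP _ (subvsP x)) addr0.
by have := h (vsproj orth (z - g (adj z))); rewrite polarE vsprojK ?sub_adj_orth.
Qed.

Definition orthq : qspace := QSpace qZ q_linear q_nondeg.

End Adjoint.

Record cospan (V W : qspace) := Cospan {
  apex : qspace;
  leg_in : isometry V apex;
  leg_out : isometry W apex }.

Definition cospan_step (V W : qspace) (c c' : cospan V W) : Prop :=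
  exists alpha : isometry (apex c) (apex c'),
    (forall v, leg_in c' v = alpha (leg_in c v))
    /\ (forall w, leg_out c' w = alpha (leg_out c w)).

Definition cospan_eq (V W : qspace) : cospan V W -> cospan V W -> Prop :=
  clos_refl_sym_trans (cospan V W) (@cospan_step V W).

Section Glue.
Variables (W X Y : qspace) (g : isometry W X) (h : isometry W Y).

(** [X] is the orthogonal sum of [W] (embedded by [g]) and [orthq g]; in these
    terms [glue] is the map [h _|_ Id], from [W _|_ orthq g]
    to [Y _|_ orthq g].  This gives composition in [Tq] on arbitrary diagrams;
    [normal_cospan_comp] identifies it with the usual formula on diagrams of
    the form [V -> W _|_ W' <- W]. *)
Definition glue_fun (x : X) : Y _|_ orthq g :=
  (h (adj g x), vsproj (orth g) (x - g (adj g x))).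

Lemma glue_linear : linear glue_fun.
Proof.
move=> a x y; congr pair; first by rewrite /= !linearP.
rewrite /= -linearP; congr vsproj.
by rewrite scalerBr addrACA -opprD [adj g _]linearP linearP.
Qed.
HB.instance Definition _ :=
  GRing.isLinear.Build 'F_2 X (Y _|_ orthq g) *:%R glue_fun glue_linear.

Lemma glue_qf x : qf (glue_fun x) = qf x.
Proof.
rewrite -[in RHS](subrK (g (adj g x)) x) qfD (orthP _ _ (sub_adj_orth g x)).
by rewrite addr0 iso_qf addrC -(iso_qf h) -{1}(vsprojK (sub_adj_orth g x)).
Qed.

Definition glue : isometry X (Y _|_ orthq g) :=
  @Isometry X (Y _|_ orthq g) glue_fun glue_qf.

Lemma glueE w : glue (g w) = (h w, 0).
Proof. by rewrite /= /glue_fun adjK subrr linear0. Qed.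

End Glue.

Definition cospan_id (V : qspace) : cospan V V := Cospan (iso_id V) (iso_id V).

Definition cospan_comp (V W Z : qspace) (c2 : cospan W Z) (c1 : cospan V W) :
    cospan V Z :=
  Cospan (iso_comp (glue (leg_out c1) (leg_in c2)) (leg_in c1))
         (iso_comp (osum_inl (apex c2) (orthq (leg_out c1))) (leg_out c2)).

Lemma cospan_eq_refl V W (c : cospan V W) : cospan_eq c c.
Proof. exact: rst_refl. Qed.

Lemma cospan_eq_sym V W (c c' : cospan V W) : cospan_eq c c' -> cospan_eq c' c.
Proof. exact: rst_sym. Qed.

Lemma cospan_eq_trans V W (a b c : cospan V W) :
  cospan_eq a b -> cospan_eq b c -> cospan_eq a c.
Proof. exact: rst_trans. Qed.

Lemma cospan_eq_ext V W X (f f' : isometry V X) (g g' : isometry W X) :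
  f =1 f' -> g =1 g' -> cospan_eq (Cospan f g) (Cospan f' g').
Proof.
by move=> ef eg; apply: rst_step; exists (iso_id X); split=> x /=;
  rewrite ?ef ?eg.
Qed.

Section Cocone.
Variables (V W Z : qspace) (c2 : cospan W Z) (c1 : cospan V W) (P : qspace).
Variables (u : isometry (apex c1) P) (v : isometry (apex c2) P).
Hypothesis uv : forall w, u (leg_out c1 w) = v (leg_in c2 w).
Hypothesis uv_orth : forall x y, x \in orth (leg_out c1) -> B (u x) (v y) = 0.

Let D := apex c2 _|_ orthq (leg_out c1).
Let m (x : D) : P := v x.1 + u (vsval x.2).

Let m_linear : linear m.
Proof. by move=> a x y; rewrite /m !linearP /= scalerDr addrACA. Qed.
HB.instance Definition _ := GRing.isLinear.Build 'F_2 D P *:%R m m_linear.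

Let m_qf x : qf (m x) = qf x.
Proof.
by rewrite /m qfD BC uv_orth ?subvsP // addr0 !iso_qf.
Qed.

(** The composite may be computed in any space in which the two apexes are
    embedded compatibly, with orthogonal complements of the middle object. *)
Lemma cospan_comp_cocone :
  cospan_eq (cospan_comp c2 c1)
            (Cospan (iso_comp u (leg_in c1)) (iso_comp v (leg_out c2))).
Proof.
apply: rst_step; exists (@Isometry D P m m_qf); split=> x /=; rewrite /m /=.
  rewrite vsprojK ?sub_adj_orth //.
  by rewrite -uv -linearD addrC subrK.
by rewrite linear0 addr0.
Qed.

End Cocone.

Lemma cospan_comp_step V W Z (c2 c2' : cospan W Z) (c1 c1' : cospan V W) :
  cospan_step c2 c2' -> cospan_step c1 c1' ->
  cospan_eq (cospan_comp c2 c1) (cospan_comp c2' c1').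
Proof.
case=> be [be_in be_out] [al [al_in al_out]].
apply: cospan_eq_trans (cospan_comp_cocone (c2 := c2) (c1 := c1)
  (u := iso_comp (glue (leg_out c1') (leg_in c2')) al)
  (v := iso_comp (osum_inl _ _) be) _ _) _.
- by move=> w; rewrite /= -al_out -be_in -[LHS]/(glue _ _ _) glueE.
- move=> x y /orthP xo; rewrite osum_BE /= linear0 addr0.
  suff -> : adj (leg_out c1') (al x) = 0 by rewrite linear0 B0l.
  by apply: adj_uniq => w; rewrite B0l al_out iso_B xo.
by apply: cospan_eq_ext => x /=; rewrite ?al_in ?be_out.
Qed.

Lemma cospan_step_refl V W (c : cospan V W) : cospan_step c c.
Proof. by exists (iso_id _). Qed.

Lemma cospan_comp_eq V W Z (c2 c2' : cospan W Z) (c1 c1' : cospan V W) :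
  cospan_eq c2 c2' -> cospan_eq c1 c1' ->
  cospan_eq (cospan_comp c2 c1) (cospan_comp c2' c1').
Proof.
move=> e2 e1; apply: (@cospan_eq_trans _ _ _ (cospan_comp c2' c1)).
  elim: e2 => [a b s|a|a b _ h|a b c _ h _ h'].
  - by apply: cospan_comp_step => //; apply: cospan_step_refl.
  - exact: cospan_eq_refl.
  - exact: cospan_eq_sym.
  - exact: cospan_eq_trans h h'.
elim: e1 => [a b s|a|a b _ h|a b c _ h _ h'].
- by apply: cospan_comp_step => //; apply: cospan_step_refl.
- exact: cospan_eq_refl.
- exact: cospan_eq_sym.
- exact: cospan_eq_trans h h'.
Qed.

Lemma cospan_comp_idl V W (c : cospan V W) :
  cospan_eq (cospan_comp (cospan_id W) c) c.
Proof.
apply: cospan_eq_trans (cospan_comp_cocone (c2 := cospan_id W) (c1 := c)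
  (u := iso_id _) (v := leg_out c) _ _) _ => //.
- by move=> x y /orthP.
- by case: c => X f g; apply: cospan_eq_ext.
Qed.

Lemma cospan_comp_idr V W (c : cospan V W) :
  cospan_eq (cospan_comp c (cospan_id V)) c.
Proof.
apply: cospan_eq_trans (cospan_comp_cocone (c2 := c) (c1 := cospan_id V)
  (u := leg_in c) (v := iso_id _) _ _) _ => //.
- move=> x y /orthP xo; suff -> : x = 0 by rewrite linear0 B0l.
  by apply: B_ext => z; rewrite B0l; apply: xo.
- by case: c => X f g; apply: cospan_eq_ext.
Qed.

Lemma cospan_compA U V W Z (c : cospan W Z) (b : cospan V W) (a : cospan U V) :
  cospan_eq (cospan_comp c (cospan_comp b a)) (cospan_comp (cospan_comp c b) a).
Proof.
apply: cospan_eq_trans (cospan_comp_cocone (c2 := c) (c1 := cospan_comp b a)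
  (u := osum_map (glue (leg_out b) (leg_in c)) (iso_id (orthq (leg_out a))))
  (v := iso_comp (osum_inl _ _) (osum_inl _ _)) _ _) _.
- by move=> w; congr pair; apply: glueE.
- move=> x y /orthP xo; rewrite !osum_BE /= !linear0 !addr0.
  suff -> : adj (leg_out b) x.1 = 0 by rewrite linear0 B0l.
  apply: adj_uniq => w; rewrite B0l -(xo w) osum_BE /= linear0 addr0 //.
by apply: cospan_eq_ext.
Qed.

Definition Tq : category :=
  @Category qspace cospan cospan_eq cospan_id cospan_comp
    cospan_eq_refl cospan_eq_sym cospan_eq_trans cospan_comp_eq
    cospan_comp_idl cospan_comp_idr cospan_compA.

Definition normal_cospan (V W W' : qspace) (f : isometry V (W _|_ W')) :
    cospan V W :=
  Cospan f (osum_inl W W').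

Lemma orth_inl (V W : qspace) (x : V _|_ W) :
  x \in orth (osum_inl V W) -> x.1 = 0.
Proof.
move/orthP => xo; apply: B_ext => y.
by rewrite B0l -(xo y) osum_BE /= linear0 addr0.
Qed.

Lemma normal_cospan_comp (V W Z W' L : qspace) (f : isometry V (W _|_ W'))
    (phi : isometry W (Z _|_ L)) :
  cospan_eq (cospan_comp (normal_cospan phi) (normal_cospan f))
    (Cospan (iso_comp (osum_map phi (iso_id W')) f)
            (iso_comp (osum_inl (Z _|_ L) W') (osum_inl Z L))).
Proof.
apply: (cospan_comp_cocone (c2 := normal_cospan phi) (c1 := normal_cospan f)
  (u := osum_map phi (iso_id W')) (v := osum_inl _ _)) => //.
move=> x y /orth_inl x0.
by rewrite osum_BE /= x0 !linear0 B0l addr0.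
Qed.

Definition cospan_osum (V1 W1 V2 W2 : qspace) (c1 : cospan V1 W1)
    (c2 : cospan V2 W2) : cospan (V1 _|_ V2) (W1 _|_ W2) :=
  Cospan (osum_map (leg_in c1) (leg_in c2)) (osum_map (leg_out c1) (leg_out c2)).

Lemma cospan_osum_step V1 W1 V2 W2 (c1 c1' : cospan V1 W1)
    (c2 c2' : cospan V2 W2) :
  cospan_step c1 c1' -> cospan_step c2 c2' ->
  cospan_step (cospan_osum c1 c2) (cospan_osum c1' c2').
Proof.
case=> al [al_in al_out] [be [be_in be_out]].
exists (osum_map al be).
by split=> x /=; rewrite /osum_map_fun ?al_in ?be_in ?al_out ?be_out.
Qed.

Lemma cospan_osum_eq V1 W1 V2 W2 (c1 c1' : cospan V1 W1)
    (c2 c2' : cospan V2 W2) :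
  cospan_eq c1 c1' -> cospan_eq c2 c2' ->
  cospan_eq (cospan_osum c1 c2) (cospan_osum c1' c2').
Proof.
move=> e1 e2; apply: (@cospan_eq_trans _ _ _ (cospan_osum c1 c2')).
  elim: e2 => [a b s|a|a b _ h|a b c _ h _ h'].
  - by apply/rst_step/cospan_osum_step => //; apply: cospan_step_refl.
  - exact: cospan_eq_refl.
  - exact: cospan_eq_sym.
  - exact: cospan_eq_trans h h'.
elim: e1 => [a b s|a|a b _ h|a b c _ h _ h'].
- by apply/rst_step/cospan_osum_step => //; apply: cospan_step_refl.
- exact: cospan_eq_refl.
- exact: cospan_eq_sym.
- exact: cospan_eq_trans h h'.
Qed.

Lemma cospan_osum_id V W :
  cospan_eq (cospan_osum (cospan_id V) (cospan_id W)) (cospan_id (V _|_ W)).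
Proof. by apply: cospan_eq_ext; case. Qed.

Lemma cospan_osum_comp V1 W1 Z1 V2 W2 Z2 (b1 : cospan W1 Z1)
    (a1 : cospan V1 W1) (b2 : cospan W2 Z2) (a2 : cospan V2 W2) :
  cospan_eq (cospan_osum (cospan_comp b1 a1) (cospan_comp b2 a2))
            (cospan_comp (cospan_osum b1 b2) (cospan_osum a1 a2)).
Proof.
apply: cospan_eq_sym.
apply: cospan_eq_trans (cospan_comp_cocone
  (c2 := cospan_osum b1 b2) (c1 := cospan_osum a1 a2)
  (u := osum_map (glue (leg_out a1) (leg_in b1))
                 (glue (leg_out a2) (leg_in b2)))
  (v := osum_map (osum_inl _ _) (osum_inl _ _)) _ _) _.
- by case=> w1 w2; congr pair; apply: glueE.
- case=> x1 x2 [y1 y2] /orthP xo.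
  suff [e1 e2] : adj (leg_out a1) x1 = 0 /\ adj (leg_out a2) x2 = 0.
    by rewrite !osum_BE /= e1 e2 !linear0 !B0l !addr0.
  split; apply: adj_uniq => w; rewrite B0l.
    by rewrite -(xo (w, 0)) osum_BE /= !linear0 addr0.
  by rewrite -(xo (0, w)) osum_BE /= !linear0 add0r.
by apply: cospan_eq_ext.
Qed.

Definition Fquad := functor Tq Vect.

Definition Fgen := functor FinVect Vect.

(** [adj (leg_out c)] is the orthogonal projection of the apex of [c] onto its
    subspace [W]; on [normal_cospan f] it is the first projection of
    [W _|_ W']. *)
Program Definition epsilon : functor Tq FinVect :=
  @Functor Tq FinVect qcarrier
    (fun (V W : qspace) (c : cospan V W) => adj (leg_out c) \o leg_in c) _ _ _.
Next Obligation.
move=> V W c c'; elim=> {c c'} [c c'|//|c c' _ h x|a b c _ h _ h' x].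
- case=> al [al_in al_out] x /=; apply: adj_uniq => w.
  by rewrite adjP al_in al_out iso_B.
- by rewrite h.
- by rewrite h h'.
Qed.
Next Obligation. by move=> V x; rewrite /= (adjK (iso_id V)). Qed.
Next Obligation.
move=> V W Z c2 c1 x /=; apply: adj_uniq => z.
by rewrite osum_BE /= linear0 addr0 adjP.
Qed.

Lemma epsilon_normal (V W W' : qspace) (f : isometry V (W _|_ W')) x :
  adj (osum_inl W W') (f x) = (f x).1.
Proof. by apply: adj_uniq => z; rewrite osum_BE /= linear0 addr0. Qed.

Definition iota_functor (G : Fgen) : Fquad := functor_comp G epsilon.

Section Kernel.
Variables (U V : lmodType 'F_2) (f : {linear U -> V}).

Definition in_ker : {pred U} := [pred x | f x == 0].

Lemma in_ker_closed : submod_closed in_ker.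
Proof.
split=> [|a x y]; rewrite !inE ?linear0 // => /eqP ex /eqP ey.
by rewrite linearP ex ey scaler0 addr0.
Qed.
HB.instance Definition _ := GRing.isSubmodClosed.Build 'F_2 U in_ker in_ker_closed.

Record kernel := Kernel { kernel_val :> U; kernel_valP : kernel_val \in in_ker }.
HB.instance Definition _ := [isSub for kernel_val].
HB.instance Definition _ := [Choice of kernel by <:].
HB.instance Definition _ := [SubChoice_isSubLmodule of kernel by <:].

End Kernel.

Section KernelMap.
Variables (U V U' V' : lmodType 'F_2) (f : {linear U -> V}).
Variables (f' : {linear U' -> V'}) (g : {linear U -> U'}) (h : {linear V -> V'}).
Hypothesis sq : forall x, f' (g x) = h (f x).

Lemma kernel_map_subproof (x : kernel f) : g (\val x) \in in_ker f'.
Proof. by rewrite inE sq (eqP (valP x)) linear0. Qed.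

Definition kernel_map (x : kernel f) : kernel f' :=
  Kernel (kernel_map_subproof x).

Lemma kernel_map_linear : linear kernel_map.
Proof. by move=> a x y; apply: val_inj; rewrite /= !linearP. Qed.
HB.instance Definition _ :=
  GRing.isLinear.Build 'F_2 (kernel f) (kernel f') *:%R kernel_map
    kernel_map_linear.
End KernelMap.

Section Difference.
Variables (D : qspace) (F : Fquad).

Definition proj_mor (V : qspace) : cospan (V _|_ D) V :=
  Cospan (iso_id (V _|_ D)) (osum_inl V D).

Definition osum_mor (V W : qspace) (c : cospan V W) :
    cospan (V _|_ D) (W _|_ D) :=
  cospan_osum c (cospan_id D).

Lemma proj_mor_natural V W (c : cospan V W) :
  cospan_eq (cospan_comp (proj_mor W) (osum_mor c))
            (cospan_comp c (proj_mor V)).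
Proof.
apply: cospan_eq_trans (cospan_comp_cocone
  (c2 := proj_mor W) (c1 := osum_mor c)
  (u := iso_id _) (v := osum_map (leg_out c) (iso_id D)) _ _) _ => //.
- by move=> x y /orthP.
apply: cospan_eq_sym.
apply: cospan_eq_trans (cospan_comp_cocone
  (c2 := c) (c1 := proj_mor V)
  (u := osum_map (leg_in c) (iso_id D)) (v := osum_inl _ _) _ _) _.
- by move=> x; congr pair; rewrite /= linear0.
- by move=> x y /orth_inl x0; rewrite osum_BE /= x0 !linear0 B0l addr0.
by apply: cospan_eq_ext => x //=; rewrite /osum_map_fun /osum_inl_fun /= linear0.
Qed.

Definition Delta_proj (V : qspace) :
    {linear (F (V _|_ D) : lmodType 'F_2) -> (F V : lmodType 'F_2)} :=
  fmap F (proj_mor V : @hom Tq (V _|_ D) V).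

Definition Delta_map (V W : qspace) (c : cospan V W) :
    {linear (F (V _|_ D) : lmodType 'F_2) -> (F (W _|_ D) : lmodType 'F_2)} :=
  fmap F (osum_mor c : @hom Tq (V _|_ D) (W _|_ D)).

Lemma Delta_square V W (c : cospan V W) x :
  Delta_proj W (Delta_map c x) =
  (fmap F (c : @hom Tq V W) : {linear _ -> _}) (Delta_proj V x).
Proof.
have e1 := fmap_comp F (proj_mor W : @hom Tq _ _) (osum_mor c : @hom Tq _ _).
have e2 := fmap_comp F (c : @hom Tq _ _) (proj_mor V : @hom Tq _ _).
have e3 := @fmap_heq _ _ F (V _|_ D) W _ _ (proj_mor_natural c).
exact: etrans (esym (e1 x)) (etrans (e3 x) (e2 x)).
Qed.

Program Definition Delta : Fquad :=
  @Functor Tq Vect (fun V : qspace => kernel (Delta_proj V))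
    (fun (V W : qspace) (c : cospan V W) => kernel_map (Delta_square c)) _ _ _.
Next Obligation.
move=> V W c c' e x; apply: val_inj.
apply: (@fmap_heq _ _ F (V _|_ D) (W _|_ D)).
exact: cospan_osum_eq e (cospan_eq_refl _).
Qed.
Next Obligation.
move=> V x; apply: val_inj.
apply: etrans (@fmap_id _ _ F (V _|_ D) (\val x)).
apply: (@fmap_heq _ _ F (V _|_ D) (V _|_ D)); exact: cospan_osum_id.
Qed.
Next Obligation.
move=> V W Z c2 c1 x; apply: val_inj.
apply: etrans (@fmap_comp _ _ F (V _|_ D) (W _|_ D) (Z _|_ D)
  (osum_mor c2) (osum_mor c1) (\val x)).
apply: (@fmap_heq _ _ F (V _|_ D) (Z _|_ D)).
apply: cospan_eq_trans (cospan_osum_comp c2 c1 (cospan_id D) (cospan_id D)).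
apply: cospan_osum_eq; first exact: cospan_eq_refl.
exact/cospan_eq_sym/cospan_comp_idl.
Qed.

End Difference.

Section Planes.
Variable i : 'F_2.

(** In the symplectic basis [(1, 0), (0, 1)] the Arf invariant is
    [plane_q (1, 0) * plane_q (0, 1) = i * i = i]. *)
Definition plane_q (x : (('F_2)^o * ('F_2)^o)%type) : 'F_2 :=
  i * x.1 ^+ 2 + x.1 * x.2 + i * x.2 ^+ 2.

Lemma plane_polarE x y : polar plane_q x y = x.1 * y.2 + x.2 * y.1.
Proof.
case: x y => [a b] [c d]; rewrite /polar /plane_q /=; move: i a b c d.
by do 5!case=> [[|[|//]] ?]; apply: val_inj.
Qed.

Lemma plane_qZ a x : plane_q (a *: x) = a ^+ 2 * plane_q x.
Proof.
case: x => [b c]; rewrite /plane_q /=; move: i a b c.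
by do 4!case=> [[|[|//]] ?]; apply: val_inj.
Qed.

Lemma plane_linear x : linear (polar plane_q x).
Proof.
move=> a y z; rewrite !plane_polarE /= !mulrDr addrACA scalerDr.
by rewrite -!scalerAr.
Qed.

Lemma plane_nondeg x : (forall y, polar plane_q x y = 0) -> x = 0.
Proof.
case: x => a b h; congr pair.
  by have := h (0, 1); rewrite plane_polarE /= mulr0 mulr1 addr0.
by have := h (1, 0); rewrite plane_polarE /= mulr0 mulr1 add0r.
Qed.

Definition plane : qspace := QSpace plane_qZ plane_linear plane_nondeg.

End Planes.

Definition H0 : qspace := plane 0.
Definition H1 : qspace := plane 1.

Definition functor_zero (F : Fquad) : Prop :=
  forall (V : qspace) (x : (F V : lmodType 'F_2)), x = 0.

Fixpoint polynomial_le (d : nat) (F : Fquad) : Prop :=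
  match d with
  | 0 => functor_zero (Delta H0 F) /\ functor_zero (Delta H1 F)
  | d'.+1 => polynomial_le d' (Delta H0 F) /\ polynomial_le d' (Delta H1 F)
  end.

Definition polynomial_functor (F : Fquad) : Prop := exists d : nat, polynomial_le d F.

(* Main.v *)
From HB Require Import structures.
From Stdlib Require Import Relation_Operators.
From mathcomp Require Import all_boot all_order all_algebra.
From mathcomp Require Import ring.
Require Import Defs.

Set Implicit Arguments.
Unset Strict Implicit.
Unset Printing Implicit Defensive.

Import GRing.Theory.
Local Open Scope ring_scope.

(** A morphism [V -> W] of [Tq] is a linear map [p : V -> W], its image under
    [epsilon], together with a subspace of [V], where the first leg lands in the
    image of [W].  Composing with [e_l = [V -> V _|_ H0 <- V]],
    [v |-> (v, (l v, 0))], for a linear form [l], keeps [p] and cuts that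
    subspace down by [ker l].

    A polynomial [F] sends every [e_l] to the identity, by induction on the
    degree: let [phi : V -> V _|_ H0] be the map [v |-> (v, (l v, 0))], [T] the
    projection [V _|_ H0 -> V] and [i] the inclusion.  Then
    [T phi = e_l = T i e_l], so [F(phi) x - F(i e_l) x] lies in
    [Delta H0 F], where [e_l _|_ Id] acts trivially.  As [(e_l _|_ Id) phi = phi e_l], [(e_l _|_ Id) i e_l = i e_l]
    and [phi] is split injective, [F(e_l) x = x].

    Hence [F] factors through [epsilon], whose image contains, up to direct
    summands, every finite-dimensional vector space. *)

(** * Isometries and the endomorphisms [e_l] of [Tq] *)

Definition linear_of (U V : lmodType 'F_2) (f : U -> V) (lf : linear f) :
    {linear U -> V} :=
  HB.pack f (GRing.isLinear.Build 'F_2 U V *:%R f lf).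

Definition isometry_of (V W : qspace) (f : V -> W) (lf : linear f)
    (qff : forall x, qf (f x) = qf x) : isometry V W :=
  @Isometry V W (linear_of lf) qff.

Lemma osum_qfE (V W : qspace) (x : V _|_ W) : qf x = qf x.1 + qf x.2.
Proof. by []. Qed.

Lemma H0_qfE (x : H0) : qf x = x.1 * x.2.
Proof. by rewrite /= /plane_q !mul0r add0r addr0. Qed.

Section Shear.
Variables (V : qspace) (l : {linear V -> ('F_2)^o}).

Definition shear_fun (v : V) : V _|_ H0 := (v, (l v, 0)).

Lemma shear_linear : linear shear_fun.
Proof.
move=> a x y; rewrite /shear_fun linearP; congr (_, (_, _)).
by rewrite /= scaler0 addr0.
Qed.

Lemma shear_qf v : qf (shear_fun v) = qf v.
Proof. by rewrite osum_qfE H0_qfE /= mulr0 addr0. Qed.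

Definition shear : isometry V (V _|_ H0) := isometry_of shear_linear shear_qf.

Definition shear_mor : cospan V V := normal_cospan shear.

End Shear.

Section Swap.
Variables V X Y : qspace.

Definition swap_fun (x : V _|_ X _|_ Y) : V _|_ Y _|_ X :=
  ((x.1.1, x.2), x.1.2).

Lemma swap_linear : linear swap_fun. Proof. by []. Qed.

Lemma swap_qf x : qf (swap_fun x) = qf x.
Proof. by rewrite !osum_qfE /= addrAC. Qed.

Definition swap : isometry (V _|_ X _|_ Y) (V _|_ Y _|_ X) :=
  isometry_of swap_linear swap_qf.

End Swap.

Lemma orth_id (V : qspace) (x : V) : x \in orth (iso_id V) -> x = 0.
Proof. by move/orthP=> xo; apply: B_ext => z; rewrite B0l; apply: xo. Qed.

(** The orthogonal of the identity is zero, so gluing along [X] adds nothing and the composite is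
    computed in [X]. *)
Lemma cospan_comp_apex (V W X : qspace) (f : isometry V X) (g : isometry W X) :
  cospan_eq (cospan_comp (Cospan (iso_id X) g) (Cospan f (iso_id X)))
            (Cospan f g).
Proof.
apply: cospan_eq_trans (cospan_comp_cocone (c2 := Cospan (iso_id X) g)
  (c1 := Cospan f (iso_id X)) (u := iso_id X) (v := iso_id X) _ _) _ => //.
  by move=> x y /orth_id ->; rewrite linear0 B0l.
exact: cospan_eq_ext.
Qed.

Lemma cospan_comp_shear (V W : qspace) (c : cospan V W)
    (l : {linear V -> ('F_2)^o}) :
  cospan_eq (cospan_comp c (shear_mor l))
    (Cospan (iso_comp (osum_map (leg_in c) (iso_id H0)) (shear l))
            (iso_comp (osum_inl (apex c) H0) (leg_out c))).
Proof.
apply: (cospan_comp_cocone (c2 := c) (c1 := shear_mor l)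
  (u := osum_map (leg_in c) (iso_id H0)) (v := osum_inl _ _)) => [w|x y].
  by congr pair; rewrite /= linear0.
by move/orth_inl=> x0; rewrite osum_BE /= x0 !linear0 B0l addr0.
Qed.

Lemma shear_mor_idem (V : qspace) (l : {linear V -> ('F_2)^o}) :
  cospan_eq (cospan_comp (shear_mor l) (shear_mor l)) (shear_mor l).
Proof.
apply: cospan_eq_trans (cospan_comp_shear _ _) _.
(* The shear along this form copies [l v] from the first [H0] into the second. *)
have fst_lin : linear (fun x : V _|_ H0 => x.2.1 : ('F_2)^o) by [].
apply/cospan_eq_sym/rst_step; exists (shear (linear_of fst_lin)).
by split.
Qed.

Lemma shear_mor_osum (V : qspace) (l : {linear V -> ('F_2)^o})
    (f : isometry V (V _|_ H0)) : (forall v, (f v).1 = v) ->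
  let c := Cospan f (iso_id (V _|_ H0)) in
  cospan_eq (cospan_comp (osum_mor H0 (shear_mor l)) c)
            (cospan_comp c (shear_mor l)).
Proof.
move=> f1 c; apply: cospan_eq_trans (cospan_comp_cocone
  (c2 := osum_mor H0 (shear_mor l)) (c1 := c)
  (u := osum_map (shear l) (iso_id H0)) (v := iso_id _) _ _) _.
- by [].
- by move=> x y /orth_id ->; rewrite linear0 B0l.
apply: cospan_eq_sym; apply: cospan_eq_trans (cospan_comp_shear _ _) _.
(* Both composites have apex [V _|_ H0 _|_ H0] and differ by exchanging the copies of [H0]; by [f1],
   [l] reads the same [v] in both. *)
apply: rst_step; exists (swap V H0 H0); split=> x //.
by rewrite /= /swap_fun /osum_map_fun /= f1.
Qed.

(** * Action of polynomial functors on [e_l] *)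

Section FmapTq.
Variable F : Fquad.

Definition Fm (V W : qspace) (c : cospan V W) :
    {linear (F V : lmodType 'F_2) -> (F W : lmodType 'F_2)} :=
  fmap F (c : @hom Tq V W).

Lemma Fm_eq V W (c c' : cospan V W) : cospan_eq c c' -> Fm c =1 Fm c'.
Proof. by move=> e; exact: (@fmap_heq _ _ F V W). Qed.

Lemma Fm_id V : Fm (cospan_id V) =1 id.
Proof. exact: (@fmap_id _ _ F V). Qed.

Lemma Fm_comp V W Z (c : cospan W Z) (c' : cospan V W) x :
  Fm (cospan_comp c c') x = Fm c (Fm c' x).
Proof. exact: (@fmap_comp _ _ F V W Z). Qed.

End FmapTq.

Definition shear_trivial (F : Fquad) : Prop :=
  forall (V : qspace) (l : {linear V -> ('F_2)^o}), Fm F (shear_mor l) =1 id.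

Lemma shear_trivial_Delta (F : Fquad) :
  shear_trivial (Delta H0 F) -> shear_trivial F.
Proof.
move=> triv V l x.
pose phi := Cospan (shear l) (iso_id (V _|_ H0)).
pose i := Cospan (osum_inl V H0) (iso_id (V _|_ H0)).
pose y := Fm F phi x - Fm F i (Fm F (shear_mor l) x).
have proj (f : isometry V (V _|_ H0)) z : Delta_proj H0 F V
    (Fm F (Cospan f (iso_id (V _|_ H0))) z) = Fm F (normal_cospan f) z.
  rewrite -[LHS]/(Fm F (proj_mor H0 V) _) -Fm_comp.
  by apply: Fm_eq; apply: cospan_comp_apex.
have y0 : y \in in_ker (Delta_proj H0 F V).
  rewrite inE /y linearB !proj subr_eq0; apply/eqP; rewrite -[LHS]Fm_id.
  apply: Fm_eq; apply: rst_step; exists (osum_inl V H0); by split.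
have := triv V l (Kernel y0) => /(congr1 (fun z => kernel_val z)).
rewrite -[LHS]/(Fm F (osum_mor H0 (shear_mor l)) y) /= /y linearB.
rewrite -!Fm_comp (Fm_eq (shear_mor_osum _ _)) //.
(* [e_l _|_ Id] passes through [i] as [e_l], which is absorbed by idempotence. *)
have -> : Fm F (cospan_comp (osum_mor H0 (shear_mor l))
    (cospan_comp i (shear_mor l))) x = Fm F (cospan_comp i (shear_mor l)) x.
  rewrite !Fm_comp -Fm_comp (Fm_eq (shear_mor_osum _ _)) // Fm_comp.
  by rewrite -(Fm_comp (shear_mor l)) (Fm_eq (shear_mor_idem l)).
move/addIr; rewrite Fm_comp.
(* The reversed cospan of [phi] is a retraction of it. *)
move/(congr1 (Fm F (Cospan (iso_id (V _|_ H0)) (shear l)))).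
have retr z : Fm F (Cospan (iso_id (V _|_ H0)) (shear l)) (Fm F phi z) = z.
  rewrite -Fm_comp (Fm_eq (cospan_comp_apex _ _)) -[RHS]Fm_id.
  apply: Fm_eq; apply/cospan_eq_sym/rst_step; exists (shear l); by split.
by rewrite !retr.
Qed.

Lemma polynomial_shear_trivial (F : Fquad) :
  polynomial_functor F -> shear_trivial F.
Proof.
case=> d; elim: d F => [|d IHd] F [dF _]; apply: shear_trivial_Delta.
  by move=> V l x; rewrite [LHS]dF [RHS]dF.
exact: IHd dF.
Qed.

(** * Erasing the orthogonal complement: factorization through [epsilon] *)

(** In [A _|_ U _|_ H0], with [e = (1, 0)] and [f = (0, 1)] in [H0], the
    isometry that fixes [A] and [f] and sends [e] to [e + k + qf k f] and [u] to
    [u + B k u f]. *)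
Section Siegel.
Variables (A U : qspace) (k : U).

Definition siegel_fun (x : A _|_ U _|_ H0) : A _|_ H0 _|_ U :=
  ((x.1.1, (x.2.1, x.2.2 + B k x.1.2 + x.2.1 * qf k)), x.1.2 + x.2.1 *: k).

Lemma siegel_linear : linear siegel_fun.
Proof.
move=> a [[x1 x2] [x3 x4]] [[y1 y2] [y3 y4]]; rewrite /siegel_fun /= linearP.
congr ((_, (_, _)), _).
  change (a * x4 + y4 + (a * B k x2 + B k y2) + (a * x3 + y3) * qf k =
    a * (x4 + B k x2 + x3 * qf k) + (y4 + B k y2 + y3 * qf k)); ring.
by rewrite [RHS]/= scalerDr scalerDl addrACA scalerA.
Qed.

Lemma siegel_qf x : qf (siegel_fun x) = qf x.
Proof.
rewrite !osum_qfE !H0_qfE /= qfD qfZ [B _ (_ *: k)]BC BZl.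
move: (qf _) (qf _) (qf _) (B _ _) x.2.1 x.2.2.
by do 6!case=> [[|[|//]] ?]; apply: val_inj.
Qed.

Definition siegel : isometry (A _|_ U _|_ H0) (A _|_ H0 _|_ U) :=
  isometry_of siegel_linear siegel_qf.

End Siegel.

Section ShearTrivial.
Variables (F : Fquad).
Hypothesis triv : shear_trivial F.

Lemma Fm_shear (V W : qspace) (c : cospan V W) (l : {linear V -> ('F_2)^o}) :
  Fm F c =1
  Fm F (Cospan (iso_comp (osum_map (leg_in c) (iso_id H0)) (shear l))
               (iso_comp (osum_inl (apex c) H0) (leg_out c))).
Proof. by move=> x; rewrite -(Fm_eq (cospan_comp_shear c l)) Fm_comp triv. Qed.

Section Complement.
Variables (V W : qspace).
Let n := \dim {:V}.
Let b := vbasis {:V}.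

Let snd_eq0 (A U : qspace) (f : isometry V (A _|_ U)) :
  (forall i : 'I_n, (f b`_i).2 = 0) -> forall v, (f v).2 = 0.
Proof.
move=> f0 v; have lin2 : linear (fun v => (f v).2).
  by move=> a x y; rewrite linearP.
rewrite -[LHS]/(linear_of lin2 v) (coord_vbasis (memvf v)) linear_sum big1 //.
by move=> i _; rewrite linearZ /= f0 scaler0.
Qed.

Let qf_snd (A U : qspace) (f : isometry V (A _|_ U)) v :
  qf (f v).2 = qf v + qf (f v).1.
Proof. by rewrite -(iso_qf f) osum_qfE addrAC addF2 add0r. Qed.

Let B_snd (A U : qspace) (f : isometry V (A _|_ U)) v w :
  B (f v).2 (f w).2 = B v w + B (f v).1 (f w).1.
Proof. by rewrite -(iso_B f) osum_BE addrAC addvv add0r. Qed.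

(** The component [h] of [f] in [U] can be erased: for a basis vector [b_i] with
    dual form [l_i], precompose with [e_(l_i)] and apply the Siegel isometry of
    [k = h b_i].  This replaces [h] by [h + l_i k], and adds to the [A]-part a
    component in [H0] which only involves [qf] and [B] on values of [h], hence
    is determined by the [A]-part of [f]. *)
Lemma Fm_complement_rec m (A U U' : qspace) (o : isometry W A)
    (f : isometry V (A _|_ U)) (f' : isometry V (A _|_ U')) :
  (forall v, (f v).1 = (f' v).1) ->
  (forall i : 'I_n, (m <= i)%N -> (f b`_i).2 = 0 /\ (f' b`_i).2 = 0) ->
  Fm F (Cospan f (iso_comp (osum_inl A U) o)) =1
  Fm F (Cospan f' (iso_comp (osum_inl A U') o)).
Proof.
elim: m A U U' o f f' => [|m IHm] A U U' o f f' ff' f0.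
  have f20 := snd_eq0 (fun i => (f0 i (leq0n i)).1).
  have f20' := snd_eq0 (fun i => (f0 i (leq0n i)).2).
  have lin1 : linear (fun v => (f v).1) by move=> a x y; rewrite linearP.
  have q1 v : qf (f v).1 = qf v.
    by rewrite -(iso_qf f) osum_qfE f20 qf0 addr0.
  (* Base case: both cospans are equivalent to the one with apex [A] and legs [p] and [o]. *)
  pose p := isometry_of lin1 q1.
  have step X (g : isometry V (A _|_ X)) : (forall v, (f v).1 = (g v).1) ->
      (forall v, (g v).2 = 0) ->
      cospan_eq (Cospan p o) (Cospan g (iso_comp (osum_inl A X) o)).
    move=> fg g2; apply: rst_step; exists (osum_inl A X); split=> // v.
    by rewrite [LHS]surjective_pairing -fg g2.
  by move=> x; rewrite -(Fm_eq (step _ f _ _)) // (Fm_eq (step _ f' _ _)).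
have [lt_mn|le_nm] := ltnP m n; last first.
  by apply: IHm => // i mi; have := leq_trans le_nm mi; rewrite leqNgt ltn_ord.
pose i := Ordinal lt_mn; pose l : {linear V -> ('F_2)^o} := coord b i.
pose red X (g : isometry V (A _|_ X)) :=
  iso_comp (siegel A (g b`_i).2)
    (iso_comp (osum_map g (iso_id H0)) (shear l)).
(* The Siegel isometry fixes the image of [W] and puts [H0] next to [A], so the induction continues
   with [A _|_ H0] in place of [A]. *)
have redE X (g : isometry V (A _|_ X)) :
    Fm F (Cospan g (iso_comp (osum_inl A X) o)) =1
    Fm F (Cospan (red X g)
      (iso_comp (osum_inl (A _|_ H0) X) (iso_comp (osum_inl A H0) o))).
  move=> x; rewrite (Fm_shear _ l); apply: Fm_eq; apply: rst_step.
  exists (siegel A (g b`_i).2); split=> // w.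
  by rewrite /= /siegel_fun /= linear0 mul0r scale0r !addr0.
move=> x; rewrite !redE; apply: IHm => [v|j mj].
  (* The new [H0] components agree because [qf_snd] and [B_snd] express them by first components. *)
  by rewrite /= /siegel_fun /= ff' !B_snd !qf_snd !ff'.
have red0 X (g : isometry V (A _|_ X)) :
    ((m < j)%N -> (g b`_j).2 = 0) -> (red X g b`_j).2 = 0.
  move=> g0; rewrite /= /l coord_free ?(basis_free (vbasisP _)) //.
  (* For [j = i] the component becomes [k + k = 0]. *)
  case: (eqVneq i j) mj => [<- _|ij]; first by rewrite scale1r addvv.
  rewrite leq_eqVlt => /orP[/eqP mj|/g0 ->]; last by rewrite scale0r addr0.
  by case/eqP: ij; apply: val_inj.
by split; apply: red0 => /f0 [].
Qed.

End Complement.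

(** [glue] puts a cospan in normal form, its image under [epsilon] being the first component;
    [Fm_complement_rec] then disposes of the second. *)
Lemma Fm_adj (V W : qspace) (c c' : cospan V W) :
  (forall v, adj (leg_out c) (leg_in c v) = adj (leg_out c') (leg_in c' v)) ->
  Fm F c =1 Fm F c'.
Proof.
move=> e.
have normal (d : cospan V W) : cospan_eq d
    (Cospan (iso_comp (glue (leg_out d) (iso_id W)) (leg_in d))
            (iso_comp (osum_inl W (orthq (leg_out d))) (iso_id W))).
  apply: rst_step; exists (glue (leg_out d) (iso_id W)); split=> // w.
  by rewrite glueE.
move=> x; rewrite (Fm_eq (normal c)) (Fm_eq (normal c')).
(* With [m] the dimension of [V], the vanishing condition is vacuous. *)
apply: (@Fm_complement_rec _ _ (\dim {:V})) => // i.
by rewrite leqNgt ltn_ord.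
Qed.

End ShearTrivial.

(** * Lifts of linear maps and of vector spaces to [Tq] *)

Section Lift.
Variables (V W : qspace) (p : {linear V -> W}).

(** The two copies of [p v] cancel in the quadratic form, so any linear map is the first component
    of an isometry. *)
Definition lift_fun (v : V) : W _|_ (V _|_ W) := (p v, (v, p v)).

Lemma lift_linear : linear lift_fun.
Proof. by move=> a x y; rewrite /lift_fun linearP. Qed.

Lemma lift_qf v : qf (lift_fun v) = qf v.
Proof. by rewrite !osum_qfE /= addrCA addF2 addr0. Qed.

Definition lift : cospan V W := normal_cospan (isometry_of lift_linear lift_qf).

Lemma lift_epsilon v : adj (osum_inl W (V _|_ W)) (lift_fun v) = p v.
Proof. exact: (epsilon_normal (isometry_of lift_linear lift_qf)). Qed.

End Lift.

Section Hyperbolic.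
Variable E : vectType 'F_2.
Let b := vbasis {:E}.

(** The evaluation form on the sum of [E] and its dual, the dual being identified with [E] through
    [b]. *)
Definition hyp_qf (x : (E * E)%type) : 'F_2 :=
  \sum_i coord b i x.1 * coord b i x.2.

Let polarE x y : polar hyp_qf x y =
  \sum_i (coord b i x.1 * coord b i y.2 + coord b i x.2 * coord b i y.1).
Proof.
rewrite /polar /hyp_qf -!big_split; apply: eq_bigr => i _ /=.
rewrite !linearD /=.
move: (coord _ _ _) (coord _ _ _) (coord _ _ _) (coord _ _ _).
by do 4!case=> [[|[|//]] ?]; apply: val_inj.
Qed.

Lemma hyp_qfZ a x : hyp_qf (a *: x) = a ^+ 2 * hyp_qf x.
Proof.
rewrite /hyp_qf mulr_sumr; apply: eq_bigr => i _; rewrite !linearZ /=.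
by rewrite mulrACA.
Qed.

Lemma hyp_linear x : linear (polar hyp_qf x).
Proof.
move=> a y z; rewrite !polarE scaler_sumr -big_split; apply: eq_bigr => i _ /=.
by rewrite !linearP /= /GRing.scale /=; ring.
Qed.

Lemma hyp_nondeg x : (forall y, polar hyp_qf x y = 0) -> x = 0.
Proof.
move=> h.
have coord0 (v : E) : (forall i, coord b i v = 0) -> v = 0.
  move=> v0; rewrite (coord_vbasis (memvf v)) big1 // => i _.
  by rewrite v0 scale0r.
have free_b := basis_free (vbasisP {:E}).
case: x h => x1 x2 h; congr pair; apply: coord0 => i.
  have := h (0, b`_i); rewrite polarE (bigD1 i) //= big1 => [|j ji].
    by rewrite coord_free // eqxx linear0 mulr1 mulr0 !addr0.
  by rewrite coord_free // eq_sym (negPf ji) linear0 !mulr0 addr0.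
have := h (b`_i, 0); rewrite polarE (bigD1 i) //= big1 => [|j ji].
  by rewrite coord_free // eqxx linear0 mulr1 mulr0 addr0 add0r.
by rewrite coord_free // eq_sym (negPf ji) linear0 !mulr0 addr0.
Qed.

Definition hyp : qspace := QSpace hyp_qfZ hyp_linear hyp_nondeg.

Lemma hyp_fst_linear : linear (fun x : hyp => x.1 : E). Proof. by []. Qed.

Lemma hyp_inl_linear : linear (fun x : E => (x, 0) : hyp).
Proof. by move=> a x y; congr pair; rewrite /= scaler0 addr0. Qed.

Definition hyp_fst : {linear hyp -> E} := linear_of hyp_fst_linear.
Definition hyp_inl : {linear E -> hyp} := linear_of hyp_inl_linear.

End Hyperbolic.

(** * The descended functor on vector spaces *)

Section Descent.
Variables (F : Fquad).
Hypothesis triv : shear_trivial F.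

Definition Flift (V W : qspace) (p : {linear V -> W}) := Fm F (lift p).

Lemma Fm_lift (V W : qspace) (c : cospan V W) (p : {linear V -> W}) :
  (forall v, adj (leg_out c) (leg_in c v) = p v) -> Fm F c =1 Flift p.
Proof. by move=> cp; apply: Fm_adj => // v; rewrite cp lift_epsilon. Qed.

Lemma Flift_eq (V W : qspace) (p p' : {linear V -> W}) :
  p =1 p' -> Flift p =1 Flift p'.
Proof. by move=> e; apply: Fm_lift => v; rewrite lift_epsilon e. Qed.

Lemma Flift_id (V : qspace) (p : {linear V -> V}) : p =1 id -> Flift p =1 id.
Proof.
move=> e x; rewrite -[RHS](Fm_id x); symmetry; apply: Fm_lift => v.
by rewrite (adjK (iso_id V)) e.
Qed.

(** It suffices to compare images under [epsilon]; the lifts themselves need not compose. *)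
Lemma Flift_comp (U V W : qspace) (p : {linear V -> W}) (p' : {linear U -> V})
    (r : {linear U -> W}) : (forall u, p (p' u) = r u) ->
  forall x, Flift p (Flift p' x) = Flift r x.
Proof.
move=> e x; rewrite -[LHS]Fm_comp; apply: Fm_lift => v.
have := fmap_comp epsilon (lift p : @hom Tq V W) (lift p' : @hom Tq U V) v.
by move=> /= ->; rewrite -e !lift_epsilon.
Qed.

(** [u] on the first summand and zero on the second: composition is respected, but the identity goes
    to an idempotent. *)
Definition hyp_map (E E' : vectType 'F_2) (u : {linear E -> E'}) :
    {linear hyp E -> hyp E'} := hyp_inl E' \o u \o hyp_fst E.

Lemma hyp_mapE (E E' : vectType 'F_2) (u : {linear E -> E'}) x :
  hyp_map u x = (u x.1, 0).
Proof. by []. Qed.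

(** A vector space [E] is a direct summand of the quadratic space [hyp E]; the
    value at [E] of the descended functor is the image, written as
    [ker (1 - e)], of the corresponding idempotent [e] of [F (hyp E)]. *)
Definition descended_compl (E : vectType 'F_2) :
    {linear (F (hyp E) : lmodType 'F_2) -> (F (hyp E) : lmodType 'F_2)} :=
  idfun \- Flift (hyp_map (idfun : {linear E -> E})).

Lemma descended_complP (E : vectType 'F_2) (x : (F (hyp E) : lmodType 'F_2)) :
  reflect (Flift (hyp_map (idfun : {linear E -> E})) x = x)
    (x \in in_ker (descended_compl E)).
Proof. by rewrite inE /descended_compl /= subr_eq0 eq_sym; apply: eqP. Qed.

Lemma descended_square (E E' : vectType 'F_2) (u : {linear E -> E'}) x :
  descended_compl E' (Flift (hyp_map u) x) =
  Flift (hyp_map u) (descended_compl E x).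
Proof.
rewrite /descended_compl /= linearB /=; congr (_ - _).
by rewrite !(Flift_comp (r := hyp_map u)).
Qed.

Definition descended_map (E E' : vectType 'F_2) (u : {linear E -> E'}) :
    {linear kernel (descended_compl E) -> kernel (descended_compl E')} :=
  kernel_map (descended_square u).

Lemma descended_map_eq (E E' : vectType 'F_2) (u u' : {linear E -> E'}) :
  u =1 u' -> descended_map u =1 descended_map u'.
Proof.
move=> e x; apply: val_inj; apply: Flift_eq => y.
by rewrite !hyp_mapE e.
Qed.

Lemma descended_map_id (E : vectType 'F_2) :
  descended_map (idfun : {linear E -> E}) =1 id.
Proof. by move=> x; apply: val_inj; apply/descended_complP/valP. Qed.

Lemma descended_map_comp (E E' E'' : vectType 'F_2) (u' : {linear E' -> E''})
    (u : {linear E -> E'}) :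
  descended_map (u' \o u) =1 descended_map u' \o descended_map u.
Proof.
move=> x; apply: val_inj; symmetry.
exact: (Flift_comp (p := hyp_map u') (p' := hyp_map u)).
Qed.

Definition descended : Fgen :=
  @Functor FinVect Vect (fun E : vectType 'F_2 => kernel (descended_compl E))
    descended_map descended_map_eq descended_map_id descended_map_comp.

Lemma eta_subproof (V : qspace) (x : (F V : lmodType 'F_2)) :
  Flift (hyp_inl V) x \in in_ker (descended_compl V).
Proof. by apply/descended_complP; apply: Flift_comp. Qed.

Definition eta_fun (V : qspace) (x : (F V : lmodType 'F_2)) :
    kernel (descended_compl V) :=
  Kernel (eta_subproof x).

Lemma eta_linear (V : qspace) : linear (@eta_fun V).
Proof. by move=> a x y; apply: val_inj; rewrite /= linearP. Qed.

Definition eta (V : qspace) :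
    {linear (F V : lmodType 'F_2) -> kernel (descended_compl V)} :=
  linear_of (@eta_linear V).

Lemma eta_inv_linear (V : qspace) :
  linear (fun x : kernel (descended_compl V) => Flift (hyp_fst V) (\val x)).
Proof. by move=> a x y; rewrite /= linearP. Qed.

(** [eta] comes from [hyp_inl] and its inverse from [hyp_fst]: one composite is the identity, the
    other the idempotent, which is trivial on the kernel. *)
Lemma isomorphic_iota_descended : functor_isomorphic F (iota_functor descended).
Proof.
exists (fun V : Tq => eta V); split=> [V W c x|V].
  pose p : {linear V -> W} := fmap epsilon c.
  apply: val_inj.
  rewrite -[LHS]/(Flift (hyp_inl W) (Fm F c x)) (@Fm_lift _ _ c p) //.
  rewrite -[RHS]/(Flift (hyp_map p) (Flift (hyp_inl V) x)).
  by rewrite !(Flift_comp (r := hyp_inl W \o p)).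
exists (linear_of (@eta_inv_linear V)); split=> x.
  by rewrite /= (Flift_comp (r := idfun)) //; apply: Flift_id.
apply: val_inj; rewrite /= (Flift_comp (r := hyp_map idfun)) //.
exact/descended_complP/valP.
Qed.

End Descent.

Theorem theorem4p5 (F : Fquad) (hF : polynomial_functor F) :
  exists G : Fgen, functor_isomorphic F (iota_functor G).
Proof.
have triv := polynomial_shear_trivial hF.
by exists (descended triv); apply: isomorphic_iota_descended.
Qed.
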